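(* Let $X\sim\mathrm{CO}(\mu;q)$ with $q(j)=\delta j^2+\beta j+\gamma$ and pmf $p$, let $S=\{\alpha,\ldots,\omega\}$ be its support and $M=|S|-1$. Assume that $\mathbb E|X|^{2n}<\infty$ for some integer $n$ with $1\le n\le M$. Then, for all $m=0,1,\ldots,n$ and $k=m,m+1,\ldots,n$, $$\Delta^m\phi_k(j)=v^{(m)}_{k-m}\,\phi_{k-m,m}(j),\qquad v^{(m)}_{k-m}=\left\{\frac{k!\,\Pi_\delta^{[m]}(k-1)}{(k-m)!\,\mathbb E[q^{[m]}(X)]}\right\}^{1/2},$$ for all $j\in\{\alpha,\ldots,\omega-m\}$ (equivalently, as an identity of polynomials), where $\phi_k$ are the standardized Rodrigues polynomials of $X$ and $\phi_{k,m}$ are the standardized Rodrigues polynomials of the random variable $X_m$ with pmf $p_m\propto q^{[m]}p$.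
   Context: An integer-valued random variable $X$ with finite mean $\mu$ and pmf $p$ satisfies $X\sim\mathrm{CO}(\mu;q)$ (Cumulative Ord family), with $q(j)=\delta j^2+\beta j+\gamma$ a real polynomial of degree at most two, if $\sum_{k\le j}(\mu-k)p(k)=q(j)p(j)$ for all $j\in\mathbb Z$. Its support $S=\{j:p(j)>0\}$ is a set of consecutive integers $\{\alpha,\ldots,\omega\}$ ($\alpha,\omega$ possibly infinite). Notation: $\Delta f(j)=f(j+1)-f(j)$, $\Delta^k$ its iterates; $f^{[k]}(x)=f(x)\cdots f(x+k-1)$, $f^{[0]}=1$; $\Pi_\delta^{[k]}(m)=\prod_{j=m}^{k+m-1}(1-j\delta)$, $\Pi_\delta^{[0]}(m)=1$; $c_k(\delta)=\Pi_\delta^{[k]}(k-1)$; $A_k=A_k(\mu;q)=\mathbb E[q^{[k]}(X)]$. Rodrigues polynomials: for $j\in S$, $P_k(j)=\frac{(-1)^k}{p(j)}\Delta^k\big[q^{[k]}(j-k)p(j-k)\big]$ (the difference being taken in $j$); it is the restriction to $S$ of a real polynomial of degree at most $k$ with coefficient of $x^k$ equal to $c_k(\delta)$. Standardized: $\phi_k(j)=[k!\,c_k(\delta)A_k]^{-1/2}P_k(j)$, $k=0,\ldots,n$. For $i\le n$, $X_i$ is the random variable with pmf $p_i\propto q^{[i]}p$, supported on $\{\alpha,\ldots,\omega-i\}$; $q_i(j)=q(j+i)/(1-2i\delta)$, $\delta_i=\delta/(1-2i\delta)$, $\mu_i=(\delta i^2+\beta i+\mu)/(1-2i\delta)$. Its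 Rodrigues polynomials are $P_{k,i}(j)=\frac{(-1)^k}{p_i(j)}\Delta^k\big[q_i^{[k]}(j-k)p_i(j-k)\big]$, and $\phi_{k,i}(j)=[k!\,c_k(\delta_i)A_k(\mu_i;q_i)]^{-1/2}P_{k,i}(j)$ with $A_k(\mu_i;q_i)=\mathbb E[q_i^{[k]}(X_i)]$; in particular $\phi_{0,i}\equiv1$ and $\phi_{k,0}=\phi_k$. *)

(* Defs.v *)
From HB Require Import structures.
From mathcomp Require Import all_boot all_order all_algebra.
From mathcomp Require Import all_classical all_reals all_analysis.

Set Implicit Arguments.
Unset Strict Implicit.
Unset Printing Implicit Defensive.

Import Order.TTheory GRing.Theory Num.Theory.
Import numFieldNormedType.Exports.

Local Open Scope classical_set_scope.
Local Open Scope ring_scope.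

(* The forward difference, on functions of an integer and on polynomials. *)
Definition fdiff (R : realType) (f : int -> R) (j : int) : R :=
  f (j + 1) - f j.

Definition pdiff (R : realType) (f : {poly R}) : {poly R} :=
  f \Po ('X + 1) - f.

(* f^{[k]}(x) = f(x) f(x+1) ... f(x+k-1) *)
Definition ascprod (R : realType) (f : R -> R) (k : nat) (x : R) : R :=
  \prod_(i < k) f (x + i%:R).

(* Pi_delta^{[k]}(m) = prod_{j=m}^{m+k-1} (1 - j delta).  The lower index m is
   an integer because c_0(delta) = Pi_delta^{[0]}(-1). *)
Definition Pi_ (R : realType) (delta : R) (k : nat) (m : int) : R :=
  \prod_(i < k) (1 - (m + i%:Z)%:~R * delta).

Definition c_ (R : realType) (k : nat) (delta : R) : R :=
  Pi_ delta k (k%:Z - 1).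

Definition quad (R : realType) (delta beta gamma x : R) : R :=
  delta * x ^+ 2 + beta * x + gamma.

Definition q_shift (R : realType) (delta beta gamma : R) (i : nat) (x : R) : R :=
  quad delta beta gamma (x + i%:R) / (1 - 2 * i%:R * delta).

Definition delta_shift (R : realType) (delta : R) (i : nat) : R :=
  delta / (1 - 2 * i%:R * delta).

Section RandomVariable.
Context (d : measure_display) (T : measurableType d) (R : realType)
  (P : probability T R).
Implicit Types (X : {RV P >-> R}) (q : R -> R).

Definition integer_valued X : Prop := forall t, X t \is a Num.int.

Definition zpmf X (j : int) : R := pmf X j%:~R.

Definition supp X : set int := [set j | 0 < zpmf X j].

(* The sum over k <= j is the series over i = j - k in nat. *)
Definition CO X (mu : R) (q : R -> R) : Prop :=
  [/\ integer_valued X,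
      P.-integrable setT (EFin \o X),
      ('E_P[X] = mu%:E)%E &
      forall j : int,
        [series (mu - (j - i%:Z)%:~R) * zpmf X (j - i%:Z)]_i @ \oo
          --> (q j%:~R * zpmf X j : R)].

(* A_k = E[q^{[k]}(X)] *)
Definition A_ X q (k : nat) : R := fine 'E_P[ascprod q k \o X].

(* The Rodrigues polynomial P_k; only its values on [supp X] are meaningful. *)
Definition rodrigues X q (k : nat) (j : int) : R :=
  (-1) ^+ k / zpmf X j *
  iter k (@fdiff R)
    (fun i : int => ascprod q k (i - k%:Z)%:~R * zpmf X (i - k%:Z)) j.

(* phi_k = [k! c_k(delta) A_k]^{-1/2} P_k, where delta is the
   coefficient of x^2 in q. *)
Definition std_rodrigues X q (delta : R) (k : nat) (j : int) : R :=
  (Num.sqrt (k`!%:R * c_ k delta * A_ X q k))^-1 * rodrigues X q k j.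

End RandomVariable.

(* {alpha, ..., omega - m} for alpha = inf S and omega = sup S, either of which
   may be infinite: alpha <= j means that some element of S is at most j, and
   j + m <= omega that some element of S is at least j + m. *)
Definition trunc_range (S : set int) (m : nat) : set int :=
  [set j | (exists2 a, S a & a <= j) /\ (exists2 b, S b & j + m%:Z <= b)].

(* Main.v *)
(* With r(x) = q(x) + x - mu, the defining relation of CO(mu; q) reads
   q(j) p(j) = r(j+1) p(j+1), so P_k is the restriction to the support of a
   function G_k[q] built from q and r alone, and p_m satisfies the same relation
   with q(. + m) and r, both divided by 1 - 2 m delta.  If r - Q is affine of
   slope a, then Delta G_k[Q] = k (a - (k-1) delta) G_{k-1}[Q(. + 1)], and
   iterating gives the derivative formula up to normalization.  The constants
   match because E[q_m^{[k-m]}(X_m)] is proportional to E[q^{[k]}(X)], and the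
   square roots can be split because (2n - 2) delta < 1.  For an infinite support
   this bound follows from the moment assumption by a tail comparison; for a
   finite one from the signs of q and r next to their zeros omega and alpha. *)
Require Import Defs.
From HB Require Import structures.
From mathcomp Require Import all_boot all_order all_algebra.
From mathcomp Require Import ring lra zify.
From mathcomp Require Import all_classical all_reals all_analysis.
From mathcomp Require Import measurable_realfun.

Set Implicit Arguments.
Unset Strict Implicit.
Unset Printing Implicit Defensive.

Import Order.TTheory GRing.Theory Num.Theory.
Import numFieldNormedType.Exports.

Local Open Scope classical_set_scope.
Local Open Scope ring_scope.

(* For a weight w with Q w = (r w)(. + 1) this is the polynomial
   (-1)^k w^{-1} nabla^k [Q^{[k]} w]: writing it as
   - w^{-1} nabla [w_1 (-1)^{k-1} w_1^{-1} nabla^{k-1} [Q(. + 1)^{[k-1]} w_1]]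
   with w_1 = Q w gives the recursion. *)
Fixpoint rodpoly (R : realType) (r : R -> R) (k : nat) (Q : R -> R) (x : R) : R :=
  if k is l.+1 then
    let F := rodpoly r l (fun y : R => Q (y + 1)) in r x * F (x - 1) - Q x * F x
  else 1.

(** * Rodrigues functions and their forward differences *)

Lemma ascprodS (R : realType) (Q : R -> R) (k : nat) (x : R) :
  ascprod Q k.+1 x = Q x * ascprod (fun y : R => Q (y + 1)) k x.
Proof.
rewrite /ascprod big_ord_recl addr0; congr (_ * _); apply: eq_bigr => i _.
by rewrite /bump/= natrD addrA addrAC.
Qed.

Lemma iter_fdiff_shift (R : realType) (f : int -> R) (c : int) (k : nat) j :
  iter k (@fdiff R) (fun i => f (i + c)) j = iter k (@fdiff R) f (j + c).
Proof.
elim: k f j => //= k IH f j; rewrite /fdiff !IH.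
by rewrite addrAC.
Qed.

(** This locality lets [phi_k], meaningful only on the support, be replaced there by a polynomial
    function before differencing. *)
Lemma eq_iter_fdiff (R : realType) (f g : int -> R) (m : nat) (j : int) :
  (forall i : nat, (i <= m)%N -> f (j + i%:Z) = g (j + i%:Z)) ->
  iter m (@fdiff R) f j = iter m (@fdiff R) g j.
Proof.
elim: m f g j => [|m IH] f g j fg; first by have := fg 0%N isT; rewrite addr0.
rewrite !iterS /fdiff; congr (_ - _); apply: IH => i lim; last exact/fg/leqW.
by have := fg i.+1 lim; rewrite intS addrA.
Qed.

Lemma iter_fdiffZ (R : realType) (c : R) (f : int -> R) (m : nat) (j : int) :
  iter m (@fdiff R) (fun i => c * f i) j = c * iter m (@fdiff R) f j.
Proof. by elim: m j => //= m IH j; rewrite /fdiff !IH mulrBr. Qed.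

(** Induction passing to [Q1 = Q(. + 1)] and [w1 = Q w]: the relation persists with the same [r],
    and the function differenced for [k + 1] is the one for [k] shifted by one. The factor [w j] is
    kept on the right, so zeros of [w] are harmless. *)
Lemma rodrigues_formula (R : realType) (r : R -> R) (k : nat) (Q : R -> R)
    (w : int -> R) (j : int) :
  (forall i : int, Q i%:~R * w i = r (i + 1)%:~R * w (i + 1)) ->
  iter k (@fdiff R) (fun i => ascprod Q k (i - k%:Z)%:~R * w (i - k%:Z)) j =
  (-1) ^+ k * rodpoly r k Q j%:~R * w j.
Proof.
elim: k Q w j => [|k IH] Q w j Hw.
  by rewrite /= /ascprod big_ord0 subr0 !mul1r.
pose Q1 (y : R) := Q (y + 1); pose w1 (i : int) := Q i%:~R * w i.
have Hw1 (i : int) : Q1 i%:~R * w1 i = r (i + 1)%:~R * w1 (i + 1).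
  by rewrite /w1 Hw /Q1 intrD mulrCA.
pose h i := ascprod Q1 k (i - k%:Z)%:~R * w1 (i - k%:Z).
have -> : (fun i : int => ascprod Q k.+1 (i - k.+1%:Z)%:~R * w (i - k.+1%:Z)) =
  (fun i => h (i + (-1))).
  apply/funext => i; rewrite ascprodS /h.
  have -> : i + -1 - k%:Z = i - k.+1%:Z by lia.
  by rewrite /w1 mulrAC mulrC mulrA.
rewrite iterS {1}/fdiff !iter_fdiff_shift addrK !(IH _ _ _ Hw1).
have -> : w1 (j - 1) = r j%:~R * w j by rewrite /w1 Hw subrK.
rewrite /w1 exprS /= -/Q1.
have -> : (j - 1)%:~R = j%:~R - 1 :> R by rewrite intrD mulrNz.
ring.
Qed.

(** The second hypothesis makes [Q] behave like a quadratic with leading coefficient [delta].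
    Passing to [Q(. + 1)] keeps both hypotheses, with slope [a - 2 * delta]. The induction
    hypothesis expresses F(x + 1) and F(x - 1) through F and H; unfolding F(x) leaves a ring
    identity. *)
Lemma rodpoly_diff (R : realType) (r : R -> R) (delta : R) (k : nat)
    (Q : R -> R) (a b e : R) :
  (forall x : R, r x = Q x + a * x + b) ->
  (forall x : R, Q (x + 1) = Q x + 2 * delta * x + e) ->
  forall x : R, rodpoly r k.+1 Q (x + 1) - rodpoly r k.+1 Q x =
    k.+1%:R * (a - k%:R * delta) * rodpoly r k (fun y : R => Q (y + 1)) x.
Proof.
elim: k Q a b e => [|k IH] Q a b e Hr HQ x.
  by rewrite mulr0n mulr1n /= !Hr HQ; ring.
pose Q1 (y : R) := Q (y + 1).
have Hr1 (y : R) : r y = Q1 y + (a - 2 * delta) * y + (b - e).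
  by rewrite /Q1 Hr HQ; ring.
have HQ1 (y : R) : Q1 (y + 1) = Q1 y + 2 * delta * y + (e + 2 * delta).
  by rewrite /Q1 !HQ; ring.
have {}IH (y : R) := IH _ _ _ _ Hr1 HQ1 y.
pose F := rodpoly r k.+1 Q1.
pose H := rodpoly r k (fun y : R => Q1 (y + 1)).
have FE (y : R) : F y = r y * H (y - 1) - Q1 y * H y by [].
have E1 : F (x + 1) = F x +
    k.+1%:R * (a - 2 * delta - k%:R * delta) * H x.
  by rewrite -IH -/F; ring.
have E2 : F (x - 1) = F x -
    k.+1%:R * (a - 2 * delta - k%:R * delta) * H (x - 1).
  by rewrite -IH -/F subrK; ring.
have G (y : R) : rodpoly r k.+2 Q y = r y * F (y - 1) - Q y * F y by [].
rewrite !G addrK E1 E2 -/Q1 -/F -[Q (x + 1)]/(Q1 x).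
have rx1 : r (x + 1) = Q (x + 1) + a * (x + 1) + b by [].
have rx : r x = Q1 x + (a - 2 * delta) * x + (b - e) by [].
have -> : r (x + 1) = Q1 x + a * (x + 1) + b by rewrite rx1.
have Q1x : Q1 x = Q x + 2 * delta * x + e by exact: HQ.
have -> : Q x = Q1 x - 2 * delta * x - e by rewrite Q1x; ring.
rewrite FE rx -/H; ring.
Qed.

(** Each step of the recursion is linear in the pair [r], [Q]. For [X_m] both carry the factor 1 /
    (1 - 2 m delta). *)
Lemma rodpolyZ (R : realType) (r : R -> R) (s : R) (k : nat) (Q : R -> R) x :
  rodpoly (fun y : R => s * r y) k (fun y : R => s * Q y) x = s ^+ k * rodpoly r k Q x.
Proof. by elim: k Q x => [|k IH] Q x; rewrite /= ?expr0 ?mul1r// !IH exprS; ring. Qed.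

Lemma Pi_S (R : realType) (delta : R) (k : nat) (m : int) :
  Pi_ delta k.+1 m = Pi_ delta k m * (1 - (m + k%:Z)%:~R * delta).
Proof. by rewrite /Pi_ big_ord_recr. Qed.

Lemma Pi_D (R : realType) (delta : R) (k l : nat) (m : int) :
  Pi_ delta (k + l) m = Pi_ delta k m * Pi_ delta l (m + k%:Z).
Proof.
elim: l => [|l IH]; first by rewrite addn0 /Pi_ big_ord0 mulr1.
by rewrite addnS !Pi_S IH mulrA PoszD addrA.
Qed.

(** After m differences [Q] is q(. + m) and r - Q has slope 1 - 2 m delta, so the next difference
    contributes (k - m) (1 - (k - 1 + m) delta): one more factor of k! / (k - m)! and one of
    [Pi_]. *)
Lemma iter_fdiff_rodpoly (R : realType) (mu delta beta gamma : R) (m k : nat) j :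
  (m <= k)%N ->
  let r (x : R) := quad delta beta gamma x + x - mu in
  iter m (@fdiff R) (fun i => rodpoly r k (quad delta beta gamma) i%:~R) j =
  k`!%:R / (k - m)`!%:R * Pi_ delta m (k%:Z - 1) *
  rodpoly r (k - m) (fun y : R => quad delta beta gamma (y + m%:R)) j%:~R.
Proof.
move=> + r; elim: m j => [|m IH] j lemk.
  rewrite /= subn0 divff ?mul1r ?pnatr_eq0 -?lt0n ?fact_gt0// /Pi_ big_ord0 mul1r.
  by congr rodpoly; apply/funext => y; rewrite addr0.
rewrite iterS /fdiff !(IH _ (ltnW lemk)) -mulrBr intrD.
have -> : (k - m = (k - m.+1).+1)%N by lia.
set l := (k - m.+1)%N.
have kE : k = (l + m.+1)%N by rewrite /l subnK.
rewrite (@rodpoly_diff _ r delta l _ (1 - 2 * m%:R * delta)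
  (- mu - delta * m%:R ^+ 2 - beta * m%:R)
  (delta * (2 * m%:R + 1) + beta)); last 2 first.
- by move=> x; rewrite /r /quad; ring.
- by move=> x; rewrite /quad; ring.
have -> : (fun y : R => quad delta beta gamma (y + 1 + m%:R)) =
          (fun y : R => quad delta beta gamma (y + m.+1%:R)).
  by apply/funext => y; rewrite -addrA nat1r.
rewrite Pi_S factS natrM invfM.
have -> : (k%:Z - 1 + m%:Z)%:~R = l%:R + 2 * m%:R :> R.
  have -> : k%:Z - 1 + m%:Z = (l + 2 * m)%N%:Z by lia.
  by rewrite -pmulrn natrD natrM.
have l0 : l.+1%:R != 0 :> R by rewrite pnatr_eq0.
have f0 : l`!%:R != 0 :> R by rewrite pnatr_eq0 -lt0n fact_gt0.
field.
by rewrite f0 nat1r l0.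
Qed.

(** * Forward differences of polynomials *)

Lemma size_pdiff (R : realType) (f : {poly R}) (k : nat) :
  (size f <= k.+1)%N -> (size (pdiff f) <= k)%N.
Proof.
move=> fk; have s2 : size ('X + 1 : {poly R}) = 2 by rewrite size_XaddC.
apply/leq_sizeP => j kj; rewrite coefB.
have [fj|jf] := leqP (size f) j; first by rewrite !nth_default ?subrr ?size_comp_poly2.
have -> : j = (size f).-1 by lia.
rewrite -[X in _ - X]lead_coefE -{1}(size_comp_poly2 f s2) -lead_coefE.
by rewrite lead_coef_comp ?s2// lead_coefXaddC expr1n mulr1 subrr.
Qed.

Lemma size_iter_pdiff (R : realType) (f : {poly R}) (m k : nat) :
  (size f <= (m + k))%N -> (size (iter m (@pdiff R) f) <= k)%N.
Proof.
elim: m k => // m IH k; rewrite addSnnS iterS => /IH.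
exact: size_pdiff.
Qed.

Lemma horner_iter_pdiff (R : realType) (f : {poly R}) (m : nat) (j : int) :
  (iter m (@pdiff R) f).[j%:~R] = iter m (@fdiff R) (fun i => f.[i%:~R]) j.
Proof.
elim: m j => // m IH j.
by rewrite !iterS /fdiff -!IH /pdiff !hornerE horner_comp !hornerE intrD.
Qed.

Lemma poly_eq0_int (R : realType) (f : {poly R}) (a : int) (k : nat) :
  (size f <= k.+1)%N ->
  (forall i : nat, (i <= k)%N -> f.[(a + i%:Z)%:~R] = 0) -> f = 0.
Proof.
move=> fk f0.
apply: (@roots_geq_poly_eq0 _ f [seq (a + i%:Z)%:~R | i <- iota 0 k.+1]).
- by apply/allP => _ /mapP[i + ->]; rewrite mem_iota => ik; apply/eqP/f0; lia.
- by rewrite map_inj_uniq ?iota_uniq// => i j /intr_inj /addrI [].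
- by rewrite size_map size_iota.
Qed.

(** * Tail estimate for the Ord recursion *)

(** Bernoulli's inequality (1 + 1/t)^N >= 1 + N/t, multiplied by t^(N+1). *)
Lemma bernoulli_homogeneous (R : realType) (t : R) (N : nat) :
  0 < t -> t ^+ N * (t + N%:R) <= t * (t + 1) ^+ N.
Proof.
move=> t0; elim: N => [|N IH]; first by rewrite !expr0; lra.
have t1 : 0 <= t + 1 by lra.
rewrite [in leRHS]exprSr mulrA; apply: le_trans (ler_wpM2r t1 IH).
rewrite exprSr -!mulrA; apply: ler_wpM2l; first by rewrite exprn_ge0 ?ltW.
have : 0 <= N%:R :> R by [].
by rewrite -natr1; nra.
Qed.

(* With [u j = q j * p j] and [c = mu + N beta - 1], the sequence
   [u j * (j + 1 + c) ^+ N] is eventually nondecreasing, by Bernoulli's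
   inequality. *)
Lemma ord_tail_lower_bound (R : realType) (p : int -> R)
    (delta beta gamma mu : R) (N : nat) (a : int) :
  let q := quad delta beta gamma in
  (forall j, a <= j -> 0 < p j) ->
  (forall j, a <= j -> 0 < q j%:~R) ->
  (forall j, a <= j -> q j%:~R * p j =
     (q (j + 1)%:~R + (j + 1)%:~R - mu) * p (j + 1)) ->
  1 <= N%:R * delta ->
  exists2 e : R, 0 < e & exists j0 : int, forall i : nat,
    e <= `|(j0 + i%:Z)%:~R| ^+ (N + 2) * p (j0 + i%:Z).
Proof.
move=> q p_gt0 q_gt0 rec Nd.
(* With this [c], N q(x) - (x - mu)(x + c) = (N delta - 1) x^2 + x + C, which is nonnegative for x
   >= |C|. The bound [B] also ensures x + c > 0, x >= 1 and x + 1 + c <= 2x. *)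
pose c := mu + N%:R * beta - 1; pose C := N%:R * gamma + c * mu.
pose B : R := 2 + `|c| + `|C|.
pose j0 := Num.max a (Num.ceil B).
have aj i : a <= j0 + i%:Z by rewrite ler_wpDr// le_max lexx.
have Bj i : B <= (j0 + i%:Z)%:~R.
  apply: le_trans (ceil_ge B) _; rewrite ler_int ler_wpDr//.
  by rewrite le_max lexx orbT.
have cc : - `|c| <= c by apply: lerNnormlW.
have cc' := ler_norm c.
have CC : - `|C| <= C by apply: lerNnormlW.
(* The bound q(x) <= D x^2 will turn the lower bound on [w] into one on x^(N+2) p(x). *)
pose D : R := 1 + `|delta| + `|beta| + `|gamma|.
have D0 : 0 < D by rewrite /D -!addrA ltr_pwDl// !addr_ge0.
have qD (x : R) : 1 <= x -> q x <= D * x ^+ 2.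
  move=> x1; have x2 : x <= x ^+ 2 by rewrite expr2 ler_peMl//; lra.
  have x3 : 0 <= x ^+ 2 := sqr_ge0 x.
  have hd := ler_wpM2r x3 (ler_norm delta).
  have hb : beta * x <= `|beta| * x ^+ 2.
    apply: le_trans (ler_wpM2l (normr_ge0 beta) x2).
    by rewrite ler_wpM2r ?ler_norm//; lra.
  have hg : gamma <= `|gamma| * x ^+ 2.
    by apply: le_trans (ler_norm _) _; rewrite ler_peMr//; lra.
  by rewrite /q /quad /D !mulrDl; lra.
pose w i := q (j0 + i%:Z)%:~R * p (j0 + i%:Z) * ((j0 + i%:Z)%:~R + 1 + c) ^+ N.
have w_mono i : w i <= w i.+1.
  rewrite /w rec; last exact: aj.
  have -> : j0 + i.+1%:Z = j0 + i%:Z + 1 by lia.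
  set j := j0 + i%:Z + 1; have jE : j = j0 + i.+1%:Z by rewrite /j; lia.
  have -> : (j0 + i%:Z)%:~R + 1 = j%:~R :> R by rewrite /j [RHS]intrD.
  have pj : 0 < p j by rewrite jE p_gt0.
  have qj : 0 < q j%:~R by rewrite jE q_gt0.
  have := Bj i.+1; rewrite -jE; set x : R := j%:~R => Bx.
  rewrite mulrAC [leRHS]mulrAC ler_pM2r//.
  have t0 : 0 < x + c by rewrite /B in Bx; have := normr_ge0 C; lra.
  (* The extra factor x + c makes the homogeneous Bernoulli inequality applicable; what then remains
     is (x - mu)(x + c) <= N q(x). *)
  rewrite -(ler_pM2l t0).
  have -> : x + 1 + c = x + c + 1 by ring.
  have Hb := bernoulli_homogeneous N t0.
  have Hq : (x - mu) * (x + c) <= N%:R * q x.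
    rewrite -subr_ge0.
    have -> : N%:R * q x - (x - mu) * (x + c) =
      (N%:R * delta - 1) * x ^+ 2 + (x + C) by rewrite /C /q /quad /c; ring.
    apply: addr_ge0; first by rewrite mulr_ge0 ?sqr_ge0// subr_ge0.
    by rewrite /B in Bx; have := normr_ge0 c; lra.
  have H : (q x + x - mu) * (x + c) <= q x * (x + c + N%:R) by lra.
  rewrite [leRHS]mulrCA; apply: le_trans (ler_wpM2l (ltW qj) Hb).
  have T0 : 0 <= (x + c) ^+ N by rewrite exprn_ge0 ?ltW.
  rewrite -subr_ge0.
  move: H; rewrite -subr_ge0 => /(mulr_ge0 T0); congr (_ <= _); ring.
have w0 : 0 < w 0%N.
  rewrite /w !mulr_gt0 ?q_gt0 ?p_gt0 ?exprn_gt0//.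
  by have := Bj 0%N; rewrite /B; have := normr_ge0 C; lra.
have w0i i : w 0%N <= w i by elim: i => // i IH; exact: le_trans IH (w_mono i).
have D2 : 0 < D * 2 ^+ N by rewrite mulr_gt0 ?exprn_gt0.
exists (w 0%N / (D * 2 ^+ N)); first by rewrite divr_gt0.
exists j0 => i; rewrite ler_pdivrMr//; apply: le_trans (w0i i) _; rewrite /w.
have := Bj i; have := p_gt0 _ (aj i); have := q_gt0 _ (aj i).
move: (p _) => y; set x : R := _%:~R => qx y0 Bx.
have [Cn cn] := (normr_ge0 C, normr_ge0 c); rewrite /B in Bx.
have x1 : 1 <= x by lra.
rewrite ger0_norm; last by lra.
have H1 : (x + 1 + c) ^+ N <= (2 * x) ^+ N by apply: lerXn2r; rewrite ?nnegrE; lra.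
have -> : x ^+ (N + 2) * y * (D * 2 ^+ N) = D * x ^+ 2 * y * (2 * x) ^+ N.
  by rewrite exprD exprMn; ring.
apply: ler_pM => //; [by rewrite mulr_ge0 ?ltW|by apply: exprn_ge0; lra|].
by rewrite ler_pM2r// qD.
Qed.

(** * Integrals of integer-valued variables as series *)

Lemma zpmf_ge0 d (T : measurableType d) (R : realType) (P : probability T R)
    (X : {RV P >-> R}) (j : int) : 0 <= zpmf X j.
Proof. exact: pmf_ge0. Qed.

Lemma ge0_integral_int_range d (T : measurableType d) (R : realType)
    (P : probability T R) (X : {RV P >-> R}) (e : nat -> int) (g : R -> R) :
  injective e -> measurable_fun setT g -> (forall x, 0 <= g x) ->
  (\int[P]_(t in X @^-1` range (fun i => (e i)%:~R : R)) (g (X t))%:E =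
   \sum_(i <oo) (g (e i)%:~R * zpmf X (e i))%:E)%E.
Proof.
move=> e_inj mg g0; pose F (i : nat) := X @^-1` [set (e i)%:~R : R].
have mF i : measurable (F i).
  by exact: measurable_funPTI.
have -> : X @^-1` range (fun i => (e i)%:~R : R) = \bigcup_i F i.
  by apply/seteqP; split=> t /= [i _ h]; exists i.
rewrite ge0_integral_bigcup//=.
- apply: eq_eseriesr => i _.
  under eq_integral => t; first by rewrite inE /F /= => ->; over.
  rewrite integral_cst// EFinM /zpmf /pmf fineK//.
  exact: fin_num_measure.
- apply: (@measurable_funS _ _ _ _ setT) => //.
  by apply/measurable_EFinP; exact: measurableT_comp.
- by move=> t _; rewrite lee_fin.
- apply/trivIsetP => i j _ _ ij; apply/seteqP; split=> // t [] /=.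
  rewrite /F /= => -> /intr_inj/e_inj ijE.
  by rewrite ijE eqxx in ij.
Qed.

Lemma nneseries_le_expectation d (T : measurableType d) (R : realType)
    (P : probability T R) (X : {RV P >-> R}) (e : nat -> int) (g : R -> R) :
  injective e -> measurable_fun setT g -> (forall x, 0 <= g x) ->
  (\sum_(i <oo) (g (e i)%:~R * zpmf X (e i))%:E <= \int[P]_t (g (X t))%:E)%E.
Proof.
move=> e_inj mg g0; rewrite -ge0_integral_int_range//.
have mr : measurable (range (fun i => (e i)%:~R : R)).
  apply: countable_measurable => [t|]; first exact: measurable_set1.
  exact: card_image_le.
apply: ge0_subset_integral => //.
- exact: measurable_funPTI.
- by apply/measurable_EFinP; exact: measurableT_comp.
- by move=> t _; rewrite lee_fin.
Qed.

Lemma ge0_integral_int d (T : measurableType d) (R : realType)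
    (P : probability T R) (X : {RV P >-> R}) (e : nat -> int) (g : R -> R) :
  integer_valued X -> injective e -> measurable_fun setT g ->
  (forall x, 0 <= g x) ->
  (forall j, (forall i, e i != j) -> g j%:~R = 0) ->
  (\int[P]_t (g (X t))%:E = \sum_(i <oo) (g (e i)%:~R * zpmf X (e i))%:E)%E.
Proof.
move=> Xint e_inj mg g0 gN; rewrite -ge0_integral_int_range//.
rewrite [RHS]integral_mkcond; congr integral; apply/funext => t.
rewrite /patch; case: ifPn => // /negP; rewrite inE /= => He.
have /intrP[j Xj] := Xint t; rewrite Xj gN// => i; apply/eqP => ij.
by apply: He; exists i => //; rewrite ij.
Qed.

(** Enumerates the integers, so that a sum over all of them becomes a series over [nat]. *)
Definition int_of_nat (i : nat) : int := if odd i then Negz i./2 else Posz i./2.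

Lemma int_of_nat_inj : injective int_of_nat.
Proof.
move=> i j; rewrite /int_of_nat; case: ifP => oi; case: ifP => oj // [ij].
  by rewrite -(odd_double_half i) -(odd_double_half j) ij oi oj.
by rewrite -(odd_double_half i) -(odd_double_half j) ij oi oj.
Qed.

Lemma int_of_nat_surj (j : int) : exists i, int_of_nat i = j.
Proof.
case: j => i; first by exists i.*2; rewrite /int_of_nat odd_double doubleK.
by exists i.*2.+1; rewrite /int_of_nat /= odd_double /= uphalf_double.
Qed.

(** The rising products of q may be negative off the support, so nonnegativity is asked of f p only.
    The negative part of f then vanishes wherever there is mass. *)
Lemma expectation_nneseries d (T : measurableType d) (R : realType)
    (P : probability T R) (X : {RV P >-> R}) (f : R -> R) :
  integer_valued X -> measurable_fun setT f ->
  (forall j : int, 0 <= f j%:~R * zpmf X j) ->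
  ('E_P[f \o X] =
   \sum_(i <oo) (f (int_of_nat i)%:~R * zpmf X (int_of_nat i))%:E)%E.
Proof.
move=> Xint mf f0; rewrite unlock integralE.
pose fp x := Num.max (f x) 0; pose fn x := Num.max (- f x) 0.
have iint (g : R -> R) : measurable_fun setT g -> (forall x, 0 <= g x) ->
    (\int[P]_t (g (X t))%:E =
     \sum_(i <oo) (g (int_of_nat i)%:~R * zpmf X (int_of_nat i))%:E)%E.
  move=> mg g0; apply: ge0_integral_int => //; first exact: int_of_nat_inj.
  by move=> j; have [i <-] := int_of_nat_surj j => /(_ i); rewrite eqxx.
have -> : (fun t => ((f \o X) t)%:E)^\+%E = (fun t => (fp (X t))%:E).
  by apply/funext => t; rewrite funeposE /fp EFin_max.
have -> : (fun t => ((f \o X) t)%:E)^\-%E = (fun t => (fn (X t))%:E).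
  by apply/funext => t; rewrite funenegE /fn EFin_max.
rewrite !iint.
- rewrite [X in (_ - X)%E]eseries0 ?sube0.
    apply: eq_eseriesr => i _; congr EFin; have := f0 (int_of_nat i).
    have [-> //|p0] := eqVneq (zpmf X (int_of_nat i)) 0; first by rewrite !mulr0.
    by rewrite pmulr_lge0 ?lt0r ?p0 ?zpmf_ge0// /fp => h; rewrite max_l.
  move=> i _ _; congr EFin; have := f0 (int_of_nat i).
  have [-> //|p0] := eqVneq (zpmf X (int_of_nat i)) 0; first by rewrite !mulr0.
  rewrite pmulr_lge0 ?lt0r ?p0 ?zpmf_ge0// /fn => h; rewrite max_r ?mul0r//.
  by rewrite oppr_le0.
- by apply: measurable_maxr => //; exact: measurable_funN.
- by move=> x; rewrite le_max lexx orbT.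
- by apply: measurable_maxr => //.
- by move=> x; rewrite le_max lexx orbT.
Qed.

(** Covers infinite [x] as well, because [fine] sends both infinities to 0. *)
Lemma fineZl (R : realDomainType) (c : R) (x : \bar R) :
  0 <= c -> fine (c%:E * x) = c * fine x.
Proof.
rewrite le_eqVlt => /predU1P[<-|c0]; first by rewrite mul0e mul0r.
by case: x => [r| |] //=; rewrite ?gt0_muley ?gt0_muleNy ?lte_fin// mulr0.
Qed.

(** [X] and [Y] may live on different probability spaces, so their expectations are compared through
    the series of their pmfs. *)
Lemma fine_expectation_scale d (T : measurableType d) (R : realType)
    (P : probability T R) (X : {RV P >-> R})
    d' (T' : measurableType d') (P' : probability T' R) (Y : {RV P' >-> R})
    (f g : R -> R) (c : R) :
  integer_valued X -> integer_valued Y ->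
  measurable_fun setT f -> measurable_fun setT g -> 0 <= c ->
  (forall j : int, 0 <= g j%:~R * zpmf X j) ->
  (forall j : int, f j%:~R * zpmf Y j = c * (g j%:~R * zpmf X j)) ->
  fine 'E_P'[f \o Y] = c * fine 'E_P[g \o X].
Proof.
move=> Xint Yint mf mg c0 g0 fg.
rewrite (expectation_nneseries Xint mg g0) expectation_nneseries//; last first.
  by move=> j; rewrite fg mulr_ge0.
rewrite -fineZl// -nneseriesZl; last by move=> i _; rewrite lee_fin.
by congr fine; apply: eq_eseriesr => i _; rewrite fg.
Qed.

(** * Sign of q and shape of the support for CO variables *)

(** Removing the first term of the series at j leaves the series at j - 1, and limits are unique. *)
Lemma CO_rec d (T : measurableType d) (R : realType) (P : probability T R)
    (X : {RV P >-> R}) (mu : R) (q : R -> R) (j : int) :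
  CO X mu q ->
  q j%:~R * zpmf X j =
  q (j - 1)%:~R * zpmf X (j - 1) + (mu - j%:~R) * zpmf X j.
Proof.
move=> [_ _ _ sumE].
pose u (j : int) (i : nat) := (mu - (j - i%:Z)%:~R) * zpmf X (j - i%:Z).
have Hj : series (u j) @ \oo --> q j%:~R * zpmf X j := sumE j.
have Hj1 : series (u (j - 1)) @ \oo --> q (j - 1)%:~R * zpmf X (j - 1) :=
  sumE (j - 1).
have : [sequence series (u j) n.+1]_n @ \oo --> q j%:~R * zpmf X j.
  by rewrite cvg_shiftS.
have -> : [sequence series (u j) n.+1]_n =
    (fun n => series (u (j - 1)) n + (mu - j%:~R) * zpmf X j).
  apply/funext => n; rewrite /series /= big_nat_recl//= addrC; congr (_ + _).
    apply: eq_bigr => i _; rewrite /u.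
    by have -> : j - i.+1%:Z = j - 1 - i%:Z by lia.
  by rewrite /u subr0.
move=> /cvg_lim <-//; apply: cvg_lim => //.
by apply: cvgD => //; exact: cvg_cst.
Qed.

Lemma integral_centered_parts d (T : measurableType d) (R : realType)
    (P : probability T R) (X : {RV P >-> R}) (mu : R) :
  P.-integrable setT (EFin \o X) -> ('E_P[X] = mu%:E)%E ->
  (\int[P]_t (Num.max (mu - X t) 0)%:E = \int[P]_t (Num.max (X t - mu) 0)%:E)%E.
Proof.
move=> iX EX; pose f (t : T) := (X t - mu)%:E.
have icst : P.-integrable setT (EFin \o cst mu).
  exact: finite_measure_integrable_cst.
have iF : P.-integrable setT f by exact: (integrableB measurableT iX icst).
have ipos : (f^\+ = fun t => (Num.max (X t - mu) 0)%:E)%E.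
  by apply/funext => t; rewrite funeposE /f EFin_max.
have ineg : (f^\- = fun t => (Num.max (mu - X t) 0)%:E)%E.
  by apply/funext => t; rewrite funenegE /f EFin_max -EFinN opprB.
have : (\int[P]_t f t = 0)%E.
  have -> : (\int[P]_t f t = \int[P]_t ((EFin \o X) \- (EFin \o cst mu)) t)%E by [].
  rewrite integralB//.
  have := expectation_cst P mu; rewrite unlock => ->.
  by move: EX; rewrite unlock => ->; rewrite -EFinD subrr.
have := integrable_neg_fin_num measurableT iF.
have := integrable_pos_fin_num measurableT iF.
rewrite [in X in _ -> _ -> X]integralE ipos ineg.
move: (integral _ _ _) (integral _ _ _) => [a| |] [b| |]//= _ _ [] /eqP.
by rewrite subr_eq0 => /eqP ->.
Qed.

(** For j <= mu all terms of the series are nonnegative. Beyond j1 = floor(mu), q(j) p(j) is q(j1)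
    p(j1) minus a partial sum of (k - mu) p(k). Since q(j1) p(j1) = E(mu - X)^+ = E(X - mu)^+, it
    dominates every such partial sum. *)
Lemma CO_ge0 d (T : measurableType d) (R : realType) (P : probability T R)
    (X : {RV P >-> R}) (mu : R) (q : R -> R) (j : int) :
  CO X mu q -> 0 <= q j%:~R * zpmf X j.
Proof.
move=> hX; have [Xint iX EX sumE] := hX.
have p0 i : 0 <= zpmf X i by exact: zpmf_ge0.
pose j1 := Num.floor mu.
have mu1 : mu < (j1 + 1)%:~R by exact: floorD1_gt.
have mu0 : j1%:~R <= mu by exact: floor_le.
have [jmu|muj] := leP j j1.
  apply: (cvgr_to_ge (sumE j)); apply: nearW => n; rewrite /series /=.
  apply: sumr_ge0 => i _; rewrite mulr_ge0// subr_ge0.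
  by apply: le_trans mu0; rewrite ler_int; lia.
pose up (i : nat) := ((j1 + 1 + i%:Z)%:~R - mu) * zpmf X (j1 + 1 + i%:Z).
have up0 i : 0 <= up i.
  rewrite mulr_ge0// subr_ge0 ltW//; apply: lt_le_trans mu1 _.
  by rewrite ler_int; lia.
have step N : q (j1 + N%:Z)%:~R * zpmf X (j1 + N%:Z) =
    q j1%:~R * zpmf X j1 - \sum_(0 <= i < N) up i.
  elim: N => [|N IH]; first by rewrite big_nil addr0 subr0.
  rewrite (CO_rec _ hX) big_nat_recr//= /up.
  have -> : j1 + N.+1%:Z - 1 = j1 + N%:Z by lia.
  rewrite IH; have -> : j1 + 1 + N%:Z = j1 + N.+1%:Z by lia.
  by ring.
have low : (\int[P]_t (Num.max (mu - X t) 0)%:E = (q j1%:~R * zpmf X j1)%:E)%E.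
  rewrite (@ge0_integral_int _ _ _ _ X (fun i => j1 - i%:Z)
    (fun x => Num.max (mu - x) 0))//.
  - apply: cvg_lim => //.
    under eq_fun do rewrite sumEFin.
    apply: cvg_EFin; first exact: nearW.
    rewrite [X in X @ _](_ : _ =
      [series (mu - (j1 - i%:Z)%:~R) * zpmf X (j1 - i%:Z)]_i)//.
    apply/funext => n; apply: eq_bigr => i _; rewrite max_l// subr_ge0.
    by apply: le_trans mu0; rewrite ler_int; lia.
  - by move=> i i' /addrI/oppr_inj[].
  - by apply: measurable_maxr => //; exact: measurable_funB.
  - by move=> x; rewrite le_max lexx orbT.
  - move=> i Hi; rewrite max_r// subr_le0 ltW//; apply: lt_le_trans mu1 _.
    rewrite ler_int leNgt; apply/negP => ij; have := Hi `|j1 - i|%N; lia.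
have := @nneseries_le_expectation _ _ _ P X (fun i => j1 + 1 + i%:Z)
    (fun x => Num.max (x - mu) 0).
rewrite -integral_centered_parts// low => Hle.
have {Hle} Hle N : \sum_(0 <= i < N) up i <= q j1%:~R * zpmf X j1.
  rewrite -lee_fin; apply: le_trans (Hle _ _ _); last 3 first.
  - by move=> i i' /addrI[].
  - by apply: measurable_maxr => //; exact: measurable_funB.
  - by move=> x; rewrite le_max lexx orbT.
  rewrite -sumEFin; have -> : (\sum_(0 <= i < N) (up i)%:E = \sum_(0 <= i < N)
     (Num.max ((j1 + 1 + i%:Z)%:~R - mu) 0 * zpmf X (j1 + 1 + i%:Z))%:E)%E.
    apply: eq_bigr => i _; rewrite max_l// subr_ge0 ltW//.
    by apply: lt_le_trans mu1 _; rewrite ler_int; lia.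
  by apply: nneseries_lim_ge => i _ _; rewrite lee_fin mulr_ge0// le_max lexx orbT.
have -> : j = j1 + `|j - j1|%N%:Z by lia.
by rewrite step subr_ge0.
Qed.

(** The sequence q(j) p(j) increases up to mu and decreases afterwards. For j < mu it is at least
    (mu - a) p(a); for j >= mu it is at least its value at b - 1, hence at least (b - mu) p(b). *)
Lemma CO_gt0 d (T : measurableType d) (R : realType) (P : probability T R)
    (X : {RV P >-> R}) (mu : R) (q : R -> R) (a b j : int) :
  CO X mu q -> supp X a -> supp X b -> a <= j -> j < b ->
  0 < q j%:~R * zpmf X j.
Proof.
move=> hX pa pb aj jb.
have p0 i : 0 <= zpmf X i by exact: zpmf_ge0.
have rec i := CO_rec i hX; have T0 i := CO_ge0 i hX.
have [jmu|muj] := ltP j%:~R mu.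
  have mono (i : nat) : q (j - i%:Z)%:~R * zpmf X (j - i%:Z) <= q j%:~R * zpmf X j.
    elim: i => [|i IH]; first by rewrite subr0.
    apply: le_trans IH; rewrite [leRHS]rec.
    have -> : j - i.+1%:Z = j - i%:Z - 1 by lia.
    rewrite lerDl mulr_ge0// subr_ge0 ltW//; apply: le_lt_trans jmu.
    by rewrite ler_int; lia.
  apply: lt_le_trans (mono `|j - a|%N).
  have -> : j - `|j - a|%N%:Z = a by lia.
  rewrite rec ltr_wpDl// mulr_gt0// subr_gt0; apply: le_lt_trans jmu.
  by rewrite ler_int.
have mono (i : nat) : q (j + i%:Z)%:~R * zpmf X (j + i%:Z) <= q j%:~R * zpmf X j.
  elim: i => [|i IH]; first by rewrite addr0.
  apply: le_trans IH; rewrite [leLHS]rec.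
  have -> : j + i.+1%:Z - 1 = j + i%:Z by lia.
  rewrite gerDl mulr_le0_ge0// subr_le0; apply: le_trans muj _.
  by rewrite ler_int; lia.
apply: lt_le_trans (mono (absz (b - 1 - j)%R)).
have -> : j + (absz (b - 1 - j)%R)%:Z = b - 1 by lia.
have -> : q (b - 1)%:~R * zpmf X (b - 1) =
    q b%:~R * zpmf X b + (b%:~R - mu) * zpmf X b by rewrite [in RHS]rec; ring.
rewrite ltr_wpDl// mulr_gt0// subr_gt0; apply: le_lt_trans muj _.
by rewrite ltr_int.
Qed.

Lemma supp_interval d (T : measurableType d) (R : realType) (P : probability T R)
    (X : {RV P >-> R}) (mu : R) (q : R -> R) (a b j : int) :
  CO X mu q -> supp X a -> supp X b -> a <= j -> j <= b -> supp X j.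
Proof.
move=> hX pa pb aj; rewrite le_eqVlt => /predU1P[->//|jb].
have := CO_gt0 hX pa pb aj jb; rewrite /supp /= [in X in _ -> X]lt0r zpmf_ge0 andbT => Tj.
by apply/eqP => pj; move: Tj; rewrite pj mulr0 ltxx.
Qed.

Lemma CO_q_gt0 d (T : measurableType d) (R : realType) (P : probability T R)
    (X : {RV P >-> R}) (mu : R) (q : R -> R) (j : int) :
  CO X mu q -> supp X j -> supp X (j + 1) -> 0 < q j%:~R.
Proof.
move=> hX pj pj1; have j1 : j < j + 1 by lia.
by have := CO_gt0 hX pj pj1 (lexx j) j1; rewrite pmulr_lgt0.
Qed.

Lemma CO_q_eq0 d (T : measurableType d) (R : realType) (P : probability T R)
    (X : {RV P >-> R}) (mu : R) (q : R -> R) (j : int) :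
  CO X mu q -> supp X j -> ~ supp X (j + 1) -> q j%:~R = 0.
Proof.
move=> hX pj pj1; have p1 : zpmf X (j + 1) = 0.
  apply/eqP; rewrite eq_le zpmf_ge0 andbT leNgt; exact/negP.
have := CO_rec (j + 1) hX; rewrite p1 addrK !mulr0 addr0 => /esym/eqP.
by rewrite mulf_eq0 => /orP[/eqP//|/eqP p0]; move: pj; rewrite /supp /= p0 ltxx.
Qed.

(** Take n + 1 distinct support points with minimum [g i0]. If none reached [g i0 + n], they would
    all fit among n integers; the interval property fills the gap. *)
Lemma supp_run d (T : measurableType d) (R : realType) (P : probability T R)
    (X : {RV P >-> R}) (mu : R) (q : R -> R) (n : nat) :
  CO X mu q -> (`I_n.+1 #<= supp X)%card ->
  exists2 a : int, supp X a & supp X (a + n%:Z).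
Proof.
move=> hX /card_leP/unsquash f.
have In (i : 'I_n.+1) : (i : nat) \in `I_n.+1 by apply/mem_set; exact: ltn_ord.
pose g (i : 'I_n.+1) : int := val (f (exist _ (i : nat) (In i))).
have gS i : supp X (g i) by exact/set_mem/valP.
have g_inj : injective g.
  move=> i i' /val_inj/(@inj _ _ _ f _ _) => h.
  by apply/val_inj; have [] := h (mem_set I) (mem_set I).
case: (@Order.TotalTheory.arg_minP _ _ _ (@ord0 n) xpredT g isT) => i0 _ gmin.
exists (g i0) => //.
have [/existsP[i gi]|/existsPn gN] := boolP [exists i, g i0 + n%:Z <= g i].
  by apply: (supp_interval hX (gS i0) (gS i)) => //; rewrite lerDl.
have : (size (codom g) <= size [seq (g i0 + k%:Z)%R | k <- iota 0 n])%N.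
  apply: uniq_leq_size; first exact/injectiveP.
  move=> _ /codomP[i ->]; have := gN i; have := gmin i isT => h1 h2.
  apply/mapP; exists `|g i - g i0|%N; rewrite ?mem_iota; lia.
by rewrite size_codom size_map size_iota card_ord ltnn.
Qed.

(** * The bound (2n - 2) delta < 1 *)

Lemma moment_summands_not_bounded_below d (T : measurableType d) (R : realType)
    (P : probability T R) (X : {RV P >-> R}) (K : nat) (e : nat -> int) (eps : R) :
  ('E_P[(fun t => `|X t| ^+ K)%R] < +oo)%E -> injective e -> 0 < eps ->
  ~ forall i, eps <= `|(e i)%:~R| ^+ K * zpmf X (e i).
Proof.
move=> mom e_inj eps0 He.
have g0 (x : R) : 0 <= `|x| ^+ K by rewrite exprn_ge0.
have mg : measurable_fun setT (fun x : R => `|x| ^+ K).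
  by apply: measurable_funX; exact: normr_measurable.
have := nneseries_le_expectation X e_inj mg g0.
move: mom; rewrite unlock => mom /le_lt_trans/(_ mom)/nnseries_is_cvg.
move=> /(_ _)/cvg_series_cvg_0 cvg0.
have : eps <= 0.
  apply: cvgr_to_ge (cvg0 _) _; last exact: nearW.
  by move=> i; apply: le_trans (He i); exact: ltW.
by rewrite leNgt eps0.
Qed.

(** Assume the contrary. On a support unbounded above, the tail estimate with N = 2n - 2 keeps the
    summands of the moment of order N + 2 = 2n away from 0; a support unbounded below is reflected.
    A finite one, from [v] to [w], satisfies q(w) = 0 and r(v) = 0. *)
Lemma CO_delta_lt d (T : measurableType d) (R : realType) (P : probability T R)
    (X : {RV P >-> R}) (mu delta beta gamma : R) (n : nat) (a : int) :
  CO X mu (quad delta beta gamma) -> (0 < n)%N ->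
  supp X a -> supp X (a + n%:Z) ->
  ('E_P[(fun t => `|X t| ^+ (2 * n))%R] < +oo)%E ->
  (2 * n.-1)%:R * delta < 1.
Proof.
move=> hX n0 Sa San mom; rewrite ltNge; apply/negP => Nd.
set q := quad delta beta gamma in hX.
pose r (x : R) := q x + x - mu.
have rec (j : int) : q j%:~R * zpmf X j = r (j + 1)%:~R * zpmf X (j + 1).
  have := CO_rec (j + 1) hX; rewrite addrK /r.
  by set y := zpmf X (j + 1); lra.
have NE : (2 * n.-1 + 2 = 2 * n)%N by lia.
have [up|/existsNP[w /not_implyP[Sw Sw1]]] :=
    pselect (forall b, supp X b -> supp X (b + 1)).
  have Sup j : a <= j -> supp X j.
    move=> aj; have -> : j = a + `|j - a|%N%:Z by lia.
    elim: `|j - a|%N => [|i IH]; first by rewrite addr0.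
    have -> : a + i.+1%:Z = a + i%:Z + 1 by lia.
    exact: up.
  have [||||eps eps0 [j0 Hj0]] := @ord_tail_lower_bound R (zpmf X) delta beta
    gamma mu (2 * n.-1) a.
  - exact: Sup.
  - by move=> j aj; apply: (CO_q_gt0 hX); apply: Sup; lia.
  - by move=> j _; rewrite -/q rec.
  - exact: Nd.
  apply: (moment_summands_not_bounded_below mom _ eps0 (e := fun i => j0 + i%:Z)).
    by move=> i i' /addrI[].
  by move=> i; rewrite -NE.
have [down|/existsNP[v /not_implyP[Sv Sv1]]] :=
    pselect (forall b, supp X b -> supp X (b - 1)).
  have Sdown j : j <= a -> supp X j.
    move=> aj; have -> : j = a - `|a - j|%N%:Z by lia.
    elim: `|a - j|%N => [|i IH]; first by rewrite subr0.
    have -> : a - i.+1%:Z = a - i%:Z - 1 by lia.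
    exact: down.
  (* the reflected variable [- X] is CO(- mu; r(- x)) *)
  have rE (x : R) : quad delta (- beta - 1) (gamma - mu) x = r (- x).
    by rewrite /r /q /quad; ring.
  have [||||eps eps0 [j0 Hj0]] := @ord_tail_lower_bound R (fun j => zpmf X (- j))
    delta (- beta - 1) (gamma - mu) (- mu) (2 * n.-1) (- a).
  - by move=> j aj; apply: Sdown; lia.
  - move=> j aj; rewrite rE.
    have Sj : supp X (- j) by apply: Sdown; lia.
    have Sj1 : supp X (- j - 1) by apply: Sdown; lia.
    have := rec (- j - 1); rewrite subrK mulrNz => rj.
    rewrite -(pmulr_lgt0 _ Sj) -rj mulr_gt0// (CO_q_gt0 hX)//.
    by rewrite subrK.
  - move=> j aj; rewrite !rE /r.
    have := rec (- j - 1); rewrite subrK /r.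
    have -> : - j - 1 = - (j + 1) by lia.
    rewrite !intrD !mulrNz intrD /= => <-.
    by congr (_ * _); rewrite /q /quad; ring.
  - exact: Nd.
  apply: (moment_summands_not_bounded_below mom _ eps0 (e := fun i => - (j0 + i%:Z))).
    by move=> i i' /oppr_inj/addrI[].
  by move=> i; rewrite -NE mulrNz normrN.
have qw : q w%:~R = 0 by exact: CO_q_eq0 hX Sw Sw1.
have rv : r v%:~R = 0.
  have p1 : zpmf X (v - 1) = 0.
    apply/eqP; rewrite eq_le zpmf_ge0 andbT leNgt; exact/negP.
  have := rec (v - 1); rewrite p1 mulr0 subrK => /esym/eqP.
  by rewrite mulf_eq0 => /orP[/eqP//|/eqP p0]; move: Sv; rewrite /supp /= p0 ltxx.
have va : v <= a.
  rewrite leNgt; apply/negP => av; apply: Sv1.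
  by apply: (supp_interval hX Sa Sv); lia.
have aw : a + n%:Z <= w.
  rewrite leNgt; apply/negP => wa; apply: Sw1.
  by apply: (supp_interval hX Sw San); lia.
have Sbetween j : v <= j -> j <= w -> supp X j by exact: supp_interval hX Sv Sw.
(* Adding the increments, q(w - 1) - q(w) + r(v + 1) - r(v) = 1 - 2 (w - v - 1) delta is positive,
   while w - v >= n. *)
have qw1 : 0 < q (w - 1)%:~R.
  by apply: (CO_q_gt0 hX); apply: Sbetween; lia.
have rv1 : 0 < r (v + 1)%:~R.
  have Sv2 : supp X (v + 1) by apply: Sbetween; lia.
  by rewrite -(pmulr_lgt0 _ Sv2) -rec mulr_gt0// (CO_q_gt0 hX).
have nE : (2 * n.-1)%:R = 2 * n%:R - 2 :> R.
  by rewrite -[in RHS](prednK n0) -natr1 natrM; ring.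
have d0 : 0 < delta.
  rewrite ltNge; apply/negP => d0; move: Nd; rewrite leNgt.
  by rewrite (le_lt_trans (mulr_ge0_le0 _ d0)).
have wv : n%:R <= w%:~R - v%:~R :> R.
  by rewrite -intrB pmulrn ler_int; lia.
move: qw rv qw1 rv1 Nd; rewrite nE /r /q /quad !intrD mulrNz.
set x : R := w%:~R; set y : R := v%:~R => qw rv qw1 rv1 Nd.
have : 0 <= (x - y - n%:R) * delta by rewrite mulr_ge0 ?subr_ge0// ltW.
lra.
Qed.

(** * Rising products of q and constants of the shifted variable *)

(** Once the product runs past the right end omega of the support it contains the factor q(omega) =
    0; before that all factors are positive. The induction therefore also records that a nonzero
    product forces j + k into the support. *)
Lemma ascprod_ge0 d (T : measurableType d) (R : realType) (P : probability T R)
    (X : {RV P >-> R}) (mu : R) (q : R -> R) (k : nat) (j : int) :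
  CO X mu q -> 0 <= ascprod q k j%:~R * zpmf X j.
Proof.
move=> hX; have : 0 <= zpmf X j by exact: zpmf_ge0.
rewrite le_eqVlt => /predU1P[<-|Sj]; first by rewrite mulr0.
suff [] : 0 <= ascprod q k j%:~R /\ (ascprod q k j%:~R != 0 -> supp X (j + k%:Z)).
  by move=> h _; rewrite mulr_ge0// ltW.
elim: k => [|k [IH0 IH]]; first by rewrite /ascprod big_ord0 addr0.
rewrite /ascprod big_ord_recr /= -/(ascprod q k j%:~R) pmulrn -intrD.
have [->|/IH Sjk] := eqVneq (ascprod q k j%:~R) 0; first by rewrite mul0r eqxx.
have jkE : j + k.+1%:Z = j + k%:Z + 1 by lia.
have [Sjk1|NSjk1] := pselect (supp X (j + k%:Z + 1)).
  by rewrite jkE mulr_ge0// ltW// (CO_q_gt0 hX).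
by rewrite (CO_q_eq0 hX Sjk NSjk1) mulr0 eqxx.
Qed.

Lemma ascprod_gt0 d (T : measurableType d) (R : realType) (P : probability T R)
    (X : {RV P >-> R}) (mu : R) (q : R -> R) (k : nat) (j : int) :
  CO X mu q -> supp X j -> supp X (j + k%:Z) -> 0 < ascprod q k j%:~R.
Proof.
move=> hX Sj Sjk; apply: prodr_gt0 => i _; rewrite pmulrn -intrD.
have ik := ltn_ord i.
by apply: (CO_q_gt0 hX); apply: (supp_interval hX Sj Sjk); lia.
Qed.

Lemma measurable_ascprod (R : realType) (q : R -> R) (k : nat) :
  measurable_fun setT q -> measurable_fun setT (ascprod q k).
Proof.
move=> mq; apply: measurable_prod => i _.
apply: (@measurableT_comp _ _ _ _ _ _ q) => //.
by apply: measurable_funD.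
Qed.

Lemma measurable_quad (R : realType) (delta beta gamma : R) :
  measurable_fun setT (quad delta beta gamma).
Proof.
apply: measurable_funD => //; apply: measurable_funD; apply: measurable_funM => //.
Qed.

Lemma ascprodD (R : realType) (q : R -> R) (m l : nat) (x : R) :
  ascprod q (m + l) x = ascprod q m x * ascprod q l (x + m%:R).
Proof.
rewrite /ascprod big_split_ord; congr (_ * _); apply: eq_bigr => i _ /=.
by rewrite natrD addrA.
Qed.

Lemma Pi_gt0 (R : realType) (delta : R) (k : nat) (m : int) :
  (forall i : nat, (i < k)%N -> 0 < 1 - (m + i%:Z)%:~R * delta) ->
  0 < Pi_ delta k m.
Proof. by move=> h; apply: prodr_gt0 => i _; exact/h/ltn_ord. Qed.

(** Both sides are the rising product of length m + 1, with its first or its last factor split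
    off. *)
Lemma ascprod_shift (R : realType) (q : R -> R) (m : nat) (x : R) :
  q x * ascprod q m (x + 1) = ascprod q m x * q (x + m%:R).
Proof.
have := ascprodD q m 1 x; have := ascprodD q 1 m x; rewrite addnC => ->.
by rewrite {1 4}/ascprod !big_ord1 !addr0.
Qed.

Lemma ascprod_q_shift (R : realType) (delta beta gamma : R) (m l : nat) (x : R) :
  ascprod (q_shift delta beta gamma m) l x =
  (1 - 2 * m%:R * delta)^-1 ^+ l * ascprod (quad delta beta gamma) l (x + m%:R).
Proof.
have -> (z : R) : z ^+ l = \prod_(i < l) z by rewrite prodr_const card_ord.
rewrite /ascprod -big_split /=.
by apply: eq_bigr => i _; rewrite /q_shift mulrC addrAC.
Qed.

(** Factor by factor, 1 - j delta_m = (1 - (j + 2m) delta) / (1 - 2 m delta). The lower index is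
    written as k - 1 + m with k = m + l, to match the tail of c_k. *)
Lemma c_delta_shift (R : realType) (delta : R) (m l : nat) :
  (0 < l)%N -> 1 - 2 * m%:R * delta != 0 ->
  c_ l (delta_shift delta m) =
  (1 - 2 * m%:R * delta)^-1 ^+ l * Pi_ delta l ((m + l)%:Z - 1 + m%:Z).
Proof.
move=> l0 s0.
have -> (z : R) : z ^+ l = \prod_(i < l) z by rewrite prodr_const card_ord.
rewrite /c_ /Pi_ -big_split /=.
apply: eq_bigr => i _; rewrite /delta_shift.
have -> : ((m + l)%:Z - 1 + m%:Z + i%:Z) = (l%:Z - 1 + i%:Z) + (2 * m)%N%:Z by lia.
rewrite [in RHS]intrD -[(2 * m)%N%:Z%:~R]pmulrn natrM.
by field.
Qed.

(** * The derivative formula, on values and on polynomials *)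

Theorem theorem7p6 (R : realType)
    (d : measure_display) (T : measurableType d) (P : probability T R)
    (X : {RV P >-> R}) (mu delta beta gamma : R) (n : nat)
    (q := quad delta beta gamma)
    (hX : CO X mu q)
    (n_gt0 : (1 <= n)%N)
    (n_le_M : (`I_n.+1 #<= supp X)%card)
    (moment : ('E_P[(fun t => `|X t| ^+ (2 * n))%R] < +oo)%E)
    (m k : nat) (le_mk : (m <= k)%N) (le_kn : (k <= n)%N)
    (d' : measure_display) (T' : measurableType d') (P' : probability T' R)
    (Xm : {RV P' >-> R}) (Xm_int : integer_valued Xm)
    (Xm_pmf : exists c : R, forall j : int,
        zpmf Xm j = c * (ascprod q m j%:~R * zpmf X j))
    (phi_k := std_rodrigues X q delta k)
    (phi_km := std_rodrigues Xm (q_shift delta beta gamma m)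
                 (delta_shift delta m) (k - m))
    (v := Num.sqrt (k`!%:R * Pi_ delta m (k%:Z - 1)
                      / ((k - m)`!%:R * A_ X q m))) :
  (forall j : int, trunc_range (supp X) m j ->
     iter m (@fdiff R) phi_k j = v * phi_km j)
  /\
  (forall f g : {poly R},
     (size f <= k.+1)%N -> (size g <= (k - m).+1)%N ->
     (forall j : int, supp X j -> f.[j%:~R] = phi_k j) ->
     (forall j : int, trunc_range (supp X) m j -> g.[j%:~R] = phi_km j) ->
     iter m (@pdiff R) f = v *: g).
Proof.
have Xint : integer_valued X by case: hX.
have [a Sa San] := supp_run hX n_le_M.
have Srun (i : nat) : (i <= n)%N -> supp X (a + i%:Z).
  by move=> lein; apply: (supp_interval hX Sa San); lia.
have Strunc j i : trunc_range (supp X) m j -> (i <= m)%N -> supp X (j + i%:Z).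
  move=> [[x Sx xj] [y Sy jy]] im.
  by apply: (supp_interval hX Sx Sy); lia.
have dlt : (2 * n.-1)%:R * delta < 1 by exact: CO_delta_lt hX n_gt0 Sa San moment.
have delta_lt (i : nat) : (i <= 2 * n.-1)%N -> 0 < 1 - i%:R * delta.
  move=> le_i; rewrite subr_gt0; have [d0|d0] := lerP delta 0.
    by apply: le_lt_trans ltr01; exact: mulr_ge0_le0.
  by apply: le_lt_trans dlt; rewrite ler_pM2r// ler_nat.
have delta_ltz (z : int) : 0 <= z -> z <= (2 * n.-1)%N%:Z -> 0 < 1 - z%:~R * delta.
  by case: z => // i _ le_i; apply: delta_lt; lia.
pose l := (k - m)%N; have kE : k = (m + l)%N by rewrite /l; lia.
pose s : R := (1 - 2 * m%:R * delta)^-1.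
(* For l > 0, m < n gives 2m <= 2n - 2. When m = n the bound does not control 1 - 2 m delta, but
   then l = 0 and only [s ^+ 0] occurs. *)
have s_gt0 : (0 < l)%N -> 0 < s.
  by move=> l0; rewrite invr_gt0 -natrM; apply: delta_lt; lia.
have sl_gt0 : 0 < s ^+ l.
  by have [->|/s_gt0] := posnP l; [rewrite expr0|exact: exprn_gt0].
(* The indices in both products lie between k - 1 and 2k - 2, hence within the bound 2n - 2. *)
have Pm_gt0 : 0 < Pi_ delta m (k%:Z - 1).
  by apply: Pi_gt0 => i im; apply: delta_ltz; lia.
have Pl_gt0 : 0 < Pi_ delta l (k%:Z - 1 + m%:Z).
  by apply: Pi_gt0 => i im; apply: delta_ltz; lia.
(* The first factor goes into [v]; the second is c_l(delta_m) up to [s ^+ l]. *)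
have cE : c_ k delta = Pi_ delta m (k%:Z - 1) * Pi_ delta l (k%:Z - 1 + m%:Z).
  by rewrite /c_ {1}kE Pi_D.
have clE : c_ l (delta_shift delta m) = s ^+ l * Pi_ delta l (k%:Z - 1 + m%:Z).
  have [->|l0] := posnP l; first by rewrite /c_ /Pi_ !big_ord0 mulr1.
  by rewrite kE c_delta_shift// -invr_eq0 gt_eqF// s_gt0.
case: Xm_pmf => c pmE.
have mq : measurable_fun setT q by exact: measurable_quad.
have am_gt0 : 0 < ascprod q m a%:~R * zpmf X a.
  by rewrite mulr_gt0// (ascprod_gt0 hX Sa)//; apply: Srun; lia.
have c_ge0 : 0 <= c by rewrite -(pmulr_lge0 _ am_gt0) -pmE zpmf_ge0.
(* The expectation of the constant 1 under p_m fixes the normalization c = 1 / A_m. *)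
have cAm : c * A_ X q m = 1.
  rewrite /A_ -(fine_expectation_scale (Y := Xm) (f := cst 1) Xint Xm_int)//.
  - by rewrite (_ : cst 1 \o Xm = cst 1)// expectation_cst.
  - exact: measurable_ascprod.
  - by move=> j; exact: ascprod_ge0 hX.
  - by move=> j; rewrite mul1r pmE.
have Akm : A_ Xm (q_shift delta beta gamma m) l = c * s ^+ l * A_ X q k.
  rewrite /A_; apply: fine_expectation_scale => //.
  - apply: measurable_ascprod; apply: measurable_funM => //.
    by apply: (measurableT_comp mq); exact: measurable_funD.
  - exact: measurable_ascprod.
  - by rewrite mulr_ge0// ltW.
  - by move=> j; exact: ascprod_ge0 hX.
  - by move=> j; rewrite pmE ascprod_q_shift kE ascprodD -/s -/q; ring.
have Ak_ge0 : 0 <= A_ X q k.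
  rewrite /A_ fine_ge0// expectation_nneseries//.
  - by apply: nneseries_ge0 => i _ _; rewrite lee_fin (ascprod_ge0 _ _ hX).
  - exact: measurable_ascprod.
  - by move=> j; exact: ascprod_ge0 hX.
have c_gt0 : 0 < c.
  rewrite lt0r c_ge0 andbT; apply: contra_eq_neq cAm => ->.
  by rewrite mul0r eq_sym oner_eq0.
have Am : A_ X q m = c^-1.
  by apply: (mulfI (lt0r_neq0 c_gt0)); rewrite cAm divff// gt_eqF.
pose r (x : R) := q x + x - mu.
have rec (j : int) : q j%:~R * zpmf X j = r (j + 1)%:~R * zpmf X (j + 1).
  have := CO_rec (j + 1) hX; rewrite addrK /r.
  by set y := zpmf X (j + 1); lra.
have phi_kE j : supp X j ->
    phi_k j = (Num.sqrt (k`!%:R * c_ k delta * A_ X q k))^-1 * rodpoly r k q j%:~R.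
  move=> Sj; rewrite /phi_k /std_rodrigues; congr (_ * _).
  rewrite /rodrigues (rodrigues_formula _ _ rec) mulrA mulrACA.
  by rewrite -exprD addnn -muln2 exprM sqrr_sign; field; exact: lt0r_neq0.
(* Both sides are proportional to [s], so this also holds for the default value [s = 0] when 1 - 2 m
   delta vanishes. *)
have recm (j : int) : q_shift delta beta gamma m j%:~R * zpmf Xm j =
    s * r (j + 1)%:~R * zpmf Xm (j + 1).
  rewrite !pmE /q_shift -/s -/q.
  have := ascprod_shift q m j%:~R; rewrite -[X in j%:~R + X]/(1%:~R) -intrD => Hs.
  transitivity (c * s * (ascprod q m (j + 1)%:~R * (r (j + 1)%:~R * zpmf X (j + 1)))).
    rewrite -rec; transitivity (c * s * zpmf X j * (q j%:~R * ascprod q m (j + 1)%:~R)).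
      by rewrite Hs; ring.
    ring.
  ring.
have values j : trunc_range (supp X) m j ->
    iter m (@fdiff R) phi_k j = v * phi_km j.
  move=> Sj; have Sj0 : supp X j by have := Strunc _ 0%N Sj isT; rewrite addr0.
  have pmj : zpmf Xm j != 0.
    rewrite pmE !mulf_neq0 ?gt_eqF//.
    by apply: (ascprod_gt0 hX Sj0); exact: Strunc.
  rewrite (eq_iter_fdiff (g := fun i =>
    (Num.sqrt (k`!%:R * c_ k delta * A_ X q k))^-1 * rodpoly r k q i%:~R)); last first.
    by move=> i im; rewrite phi_kE//; exact: Strunc.
  rewrite iter_fdiffZ iter_fdiff_rodpoly//.
  rewrite /phi_km /std_rodrigues /rodrigues -/l.
  rewrite (@rodrigues_formula R (fun y => s * r y) l _ (zpmf Xm) j recm).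
  rewrite Akm clE cE /v -/l Am.
  have -> : q_shift delta beta gamma m = (fun y => s * q (y + m%:R)).
    by apply/funext => y; rewrite /q_shift mulrC.
  rewrite (rodpolyZ r s l (fun y => q (y + m%:R))) -/q -/r.
  set G := rodpoly _ _ _ _.
  set Pm := Pi_ delta m _ in Pm_gt0 *; set Pl := Pi_ delta l _ in Pl_gt0 *.
  set sl := s ^+ l in sl_gt0 *; set A := A_ X q k in Ak_ge0 *.
  have sign2 : (-1) ^+ l * (-1) ^+ l = 1 :> R by rewrite -expr2 sqrr_sign.
  have -> : (-1) ^+ l / zpmf Xm j * ((-1) ^+ l * (sl * G) * zpmf Xm j) = sl * G.
    transitivity ((-1) ^+ l * (-1) ^+ l * (sl * G)); last by rewrite sign2 mul1r.
    by field.
  have k0 : 0 < k`!%:R :> R by rewrite ltr0n fact_gt0.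
  have l0 : 0 < l`!%:R :> R by rewrite ltr0n fact_gt0.
  set kf : R := k`!%:R in k0 *; set lf : R := l`!%:R in l0 *.
  (* The three square roots become x y for phi_k, x z for v and l! s^l z y for the shifted
     polynomial, while k! Pi = x^2. *)
  pose x := Num.sqrt (kf * Pm); pose y := Num.sqrt (Pl * A).
  pose z := Num.sqrt (c / lf).
  have x_gt0 : 0 < x by rewrite sqrtr_gt0 mulr_gt0.
  have z_gt0 : 0 < z by rewrite sqrtr_gt0 divr_gt0.
  have x2 : kf * Pm = x * x by rewrite -expr2 sqr_sqrtr// ltW// mulr_gt0.
  have -> : Num.sqrt (kf * (Pm * Pl) * A) = x * y.
    by rewrite mulrA -mulrA sqrtrM// ltW// mulr_gt0.
  have -> : Num.sqrt (kf * Pm / (lf / c)) = x * z.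
    by rewrite invf_div sqrtrM// ltW// mulr_gt0.
  have -> : Num.sqrt (lf * (sl * Pl) * (c * sl * A)) = lf * sl * z * y.
    have -> : lf * (sl * Pl) * (c * sl * A) = (lf * sl) ^+ 2 * (c / lf) * (Pl * A).
      by field; rewrite gt_eqF.
    rewrite sqrtrM ?mulr_ge0 ?sqr_ge0 ?invr_ge0 1?ltW//.
    by rewrite sqrtrM ?sqr_ge0// sqrtr_sqr gtr0_norm// mulr_gt0.
  (* Both sides carry the factor [y^-1], abstracted because only [0 <= A] is known of [A]. *)
  rewrite [kf / lf * Pm]mulrAC x2 !invfM; move: (y^-1) => w.
  by field; rewrite !gt_eqF.
split=> //.
move=> f g sf sg fE gE.
apply/eqP; rewrite -subr_eq0; apply/eqP.
(* Both polynomials have degree at most l and agree at the l + 1 points a, ..., a + l, which lie in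
   the truncated range because a + k is in the support. *)
apply: (@poly_eq0_int _ _ a l).
  rewrite (leq_trans (size_polyD _ _))// geq_max size_polyN.
  rewrite (leq_trans (size_scale_leq _ _))// andbT.
  by apply: size_iter_pdiff; rewrite addnS -kE.
move=> i il; have Si : trunc_range (supp X) m (a + i%:Z).
  split; first by exists a => //; rewrite lerDl.
  exists (a + k%:Z); first exact: Srun.
  by rewrite -addrA lerD2l -PoszD lez_nat kE addnC leq_add2l.
rewrite !hornerE horner_iter_pdiff gE// -values//; apply/eqP.
rewrite subr_eq0; apply/eqP/eq_iter_fdiff => j jm.
by apply: fE; exact: Strunc.
Qed.
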